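(* (UGS small-gain theorem in summation formulation.) Let $I$ be a nonempty countable index set, let $(X_i,\|\cdot\|_{X_i})$, $i\in I$, be normed spaces and let $\Sigma_i=(X_i,\mathrm{PC}_b(\mathbb{R}_+,X_{\neq i})\times\mathcal{U},\bar\phi_i)$, $i\in I$, be forward complete control systems. Assume that the interconnection $\Sigma=(X,\mathcal{U},\phi)$ of the systems $\Sigma_i$ is well-defined. Furthermore, assume: (i) Each system $\Sigma_i$ is UGS in summation formulation, with $\sigma_i\in\mathcal{K}$ and nonlinear gains $\gamma_{ij},\gamma_i\in\mathcal{K}\cup\{0\}$ ($j\in I$). (ii) There exist $\sigma_{\max}\in\mathcal{K}_\infty$ and $\gamma_{\max}\in\mathcal{K}_\infty$ such that $\sigma_i\le\sigma_{\max}$ and $\gamma_i\le\gamma_{\max}$ pointwise for all $i\in I$. (iii) For the gains $\gamma_{ij}$ from (i) it holds that $\sup_{i\in I}\sum_{j\in I}\gamma_{ij}(r)<\infty$ for every $r>0$, and, for the operator $\Gamma_\boxplus:\ell_\infty(I)^+\to\ell_\infty(I)^+$, $\Gamma_\boxplus(s):=(\sum_{j\in I}\gamma_{ij}(s_j))_{i\in I}$, the operator $\mathrm{id}-\Gamma_\boxplus$ has the MBI property. Then $\Sigma$ is forward complete and UGS.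
   Context: **Comparison functions.** $\mathcal{K}$: continuous strictly increasing $\gamma:\mathbb{R}_+\to\mathbb{R}_+$ with $\gamma(0)=0$. $\mathcal{K}_\infty$: unbounded functions in $\mathcal{K}$. In $\mathcal{K}\cup\{0\}$, $0$ is the zero function. **Sequence spaces.** $\ell_\infty(I)$ is the Banach space of bounded functions $x:I\to\mathbb{R}$ with the sup-norm; $\ell_\infty(I)^+$ is the cone of its componentwise nonnegative elements; $\le$ is the componentwise order. For $w:J\to W$ bounded, $J\subset\mathbb{R}_+$ nonempty, $W$ normed, $\|w\|_J:=\sup_{s\in J}\|w(s)\|_W$. **MBI property.** For an ordered Banach space $(X,X^+)$ and a (nonlinear) operator $A:X^+\to X^+$, $\mathrm{id}-A$ has the monotone bounded invertibility (MBI) property if there is $\xi\in\mathcal{K}_\infty$ such that for all $v,w\in X^+$: $(\mathrm{id}-A)(v)\le w$ implies $\|v\|_X\le\xi(\|w\|_X)$. Here it is used with $X=\ell_\infty(I)$, $X^+=\ell_\infty(I)^+$. **Control systems.** A control system is a triple $\Sigma=(X,\mathcal{U},\phi)$ with: a normed space $(X,\|\cdot\|_X)$ (state space); a vector space $U$ of input values and a normed space of inputs $(\mathcal{U},\|\cdot\|_{\mathcal{U}})$, $\mathcal{U}$ a linear subspace of $U^{\mathbb{R}_+}$ (all maps $\mathbb{R}_+\to U$), satisfying shift invariance (for all $u\in\mathcal{U}$, $\tau\ge0$: $u(\cdot+\tau)\in\mathcal{U}$ and $\|u\|_{\mathcal{U}}\ge\|u(\cdot+\tau)\|_{\mathcal{U}}$)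 and concatenation (for all $u_1,u_2\in\mathcal{U}$, $t>0$, the function equal to $u_1(\tau)$ for $\tau\in[0,t]$ and $u_2(\tau-t)$ for $\tau>t$ is in $\mathcal{U}$); a transition map $\phi:D_\phi\to X$, $D_\phi\subseteq\mathbb{R}_+\times X\times\mathcal{U}$, such that for all $(x,u)$ one has $D_\phi\cap(\mathbb{R}_+\times\{(x,u)\})=[0,t_m)\times\{(x,u)\}$ for some $t_m=t_m(x,u)\in(0,\infty]$. The following axioms are required: $\phi(0,x,u)=x$; causality (if $(t,x,u)\in D_\phi$ and $\tilde u\in\mathcal{U}$ agrees with $u$ on $[0,t]$, then $[0,t]\times\{(x,\tilde u)\}\subset D_\phi$ and $\phi(t,x,u)=\phi(t,x,\tilde u)$); continuity of $t\mapsto\phi(t,x,u)$ on $[0,t_m(x,u))$; cocycle property (if $[0,t+h]\times\{(x,u)\}\subset D_\phi$, $t,h\ge 0$, then $\phi(h,\phi(t,x,u),u(t+\cdot))=\phi(t+h,x,u)$). $\Sigma$ is forward complete if $D_\phi=\mathbb{R}_+\times X\times\mathcal{U}$. $\Sigma$ has the boundedness-implies-continuation (BIC) property if for each $(x,u)$ with $t_m(x,u)<\infty$ and each $M>0$ there is $t\in[0,t_m)$ with $\|\phi(t,x,u)\|_X>M$. **UGS.** $\Sigma$ is uniformly globally stable (UGS) if there are $\sigma\in\mathcal{K}_\infty$, $\gamma\in\mathcal{K}\cup\{0\}$ with $\|\phi(t,x,u)\|_X\le\sigma(\|x\|_X)+\gamma(\|u\|_{\mathcal{U}})$ for all $(t,x,u)\in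 D_\phi$. **Interconnections.** Given normed spaces $X_i$, $i\in I$, put $X:=\{(x_i)_{i\in I}\in\prod_i X_i:\sup_i\|x_i\|_{X_i}<\infty\}$ with $\|x\|_X:=\sup_i\|x_i\|_{X_i}$, and let $X_{\neq i}$ be the same construction for the index set $I\setminus\{i\}$. $\mathrm{PC}_b(\mathbb{R}_+,X_{\neq i})$ is the space of globally bounded piecewise continuous functions $w:\mathbb{R}_+\to X_{\neq i}$ with sup-norm $\|w\|_\infty$. $\mathcal{U}$ is a fixed normed space of inputs (satisfying shift invariance and concatenation), common to all subsystems, and $\mathrm{PC}_b(\mathbb{R}_+,X_{\neq i})\times\mathcal{U}$ has norm $\max\{\|w\|_\infty,\|u\|_{\mathcal{U}}\}$. Given control systems $\Sigma_i=(X_i,\mathrm{PC}_b(\mathbb{R}_+,X_{\neq i})\times\mathcal{U},\bar\phi_i)$, consider maps $\phi:D_\phi\to X$, $D_\phi\subset\mathbb{R}_+\times X\times\mathcal{U}$, such that (1) for each $(x,u)\in X\times\mathcal{U}$ there is $\varepsilon>0$ with $[0,\varepsilon]\times\{(x,u)\}\subset D_\phi$; (2) the components satisfy $\phi_i(t,x,u)=\bar\phi_i(t,x_i,(\phi_{\neq i},u))$ for all $(t,x,u)\in D_\phi$, $i\in I$, where $\phi_{\neq i}(\cdot)=(\phi_j(\cdot,x,u))_{j\in I\setminus\{i\}}$ (by causality only the values of $\phi_{\neq i}$ on $[0,t]$ matter, so it can be regarded as globally bounded); and $\phi$ is maximal, i.e. no proper extension of $\phi$ satisfies these properties. If the map $\phi$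 with these properties is unique and $\Sigma=(X,\mathcal{U},\phi)$ is a control system satisfying the BIC property, then $\Sigma$ is called the (well-defined) interconnection of the $\Sigma_i$. **UGS of $\Sigma_i$ in summation formulation.** $\Sigma_i$ is forward complete and there are $\sigma_i$ and $\gamma_{ij},\gamma_i\in\mathcal{K}\cup\{0\}$ ($j\in I$) such that for all $x_i\in X_i$, $w_{\neq i}=(w_j)_{j\in I\setminus\{i\}}\in\mathrm{PC}_b(\mathbb{R}_+,X_{\neq i})$, $u\in\mathcal{U}$, $t\ge0$: $\|\bar\phi_i(t,x_i,(w_{\neq i},u))\|_{X_i}\le\sigma_i(\|x_i\|_{X_i})+\sum_{j\in I}\gamma_{ij}(\|w_j\|_{[0,t]})+\gamma_i(\|u\|_{\mathcal{U}})$, where $\sum_{j\in I}\gamma_{ij}(r)<\infty$ for every $r\ge0$ and $\gamma_{ii}=0$ (so the term $j=i$ is $0$). *)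

(* Defs.v *)
From HB Require Import structures.
From mathcomp Require Import all_boot all_order all_algebra.
From mathcomp Require Import all_classical all_reals all_analysis.

Set Implicit Arguments.
Unset Strict Implicit.
Unset Printing Implicit Defensive.

Import Order.TTheory GRing.Theory Num.Theory numFieldNormedType.Exports.

Local Open Scope classical_set_scope.
Local Open Scope ring_scope.

HB.instance Definition _ (R : realType) :=
  Topological.copy {nonneg R} (@initial_topology {nonneg R} R (fun t => t%:num)).
HB.instance Definition _ (R : realType) :=
  Uniform.copy {nonneg R} (@initial_topology {nonneg R} R (fun t => t%:num)).
HB.instance Definition _ (R : realType) :=
  PseudoMetric.copy {nonneg R}
    (@initial_topology {nonneg R} R (fun t => t%:num)).

Definition add_time (R : realType) (t s : {nonneg R}) : {nonneg R} :=
  (t%:num + s%:num)%:nng.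

Definition dist_time (R : realType) (t s : {nonneg R}) : {nonneg R} :=
  `|t%:num - s%:num|%:nng.

Definition shift (R : realType) (V : Type) (tau : {nonneg R})
    (f : {nonneg R} -> V) : {nonneg R} -> V :=
  fun t => f (add_time t tau).

(* [dist_time s t] is s - t whenever t < s. *)
Definition concat (R : realType) (V : Type) (t : {nonneg R})
    (f g : {nonneg R} -> V) : {nonneg R} -> V :=
  fun s => if s <= t then f s else g (dist_time s t).

Record linf (R : realType) (J : Type) (V : J -> normedModType R) := Linf {
  linf_fun :> forall j, V j ;
  linf_bounded : `[< exists M : R, forall j, `|linf_fun j| <= M >] }.

Section linf_normed.
Variables (R : realType) (J : Type) (V : J -> normedModType R).
Local Notation E := (linf V).
Implicit Types x y z : E.

HB.instance Definition _ :=
  [isSub of E for (@linf_fun R J V)].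

HB.instance Definition _ := gen_eqMixin E.
HB.instance Definition _ := gen_choiceMixin E.

Lemma linfP x y : (forall j, x j = y j) -> x = y.
Proof.
by move=> xy; apply/val_inj => /=; apply: functional_extensionality_dep.
Qed.

Lemma linf_ex x : exists M : R, forall j, `|x j| <= M.
Proof. exact/asboolP/(linf_bounded x). Qed.

Lemma linf0_subproof : `[< exists M : R, forall j, `|0 : V j| <= M >].
Proof. by apply/asboolP; exists 0 => j; rewrite normr0. Qed.
Lemma linfN_subproof x : `[< exists M : R, forall j, `|- x j| <= M >].
Proof. by apply/asboolP; case: (linf_ex x) => M xM; exists M => j; rewrite normrN. Qed.
Lemma linfD_subproof x y : `[< exists M : R, forall j, `|x j + y j| <= M >].
Proof.
apply/asboolP; case: (linf_ex x) => M xM; case: (linf_ex y) => N yN.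
by exists (M + N) => j; apply: le_trans (ler_normD _ _) _; exact: lerD.
Qed.
Lemma linfZ_subproof (a : R) x : `[< exists M : R, forall j, `|a *: x j| <= M >].
Proof.
apply/asboolP; case: (linf_ex x) => M xM.
by exists (`|a| * M) => j; rewrite normrZ ler_wpM2l ?xM.
Qed.

Definition linf0 : E := @Linf R J V (fun=> 0) linf0_subproof.
Definition linfN x : E := @Linf R J V (fun j => - x j) (linfN_subproof x).
Definition linfD x y : E := @Linf R J V (fun j => x j + y j) (linfD_subproof x y).
Definition linfZ a x : E := @Linf R J V (fun j => a *: x j) (linfZ_subproof a x).

Let addA : associative linfD.
Proof. by move=> x y z; apply: linfP => j /=; rewrite addrA. Qed.
Let addC : commutative linfD.
Proof. by move=> x y; apply: linfP => j /=; rewrite addrC. Qed.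
Let add0 : left_id linf0 linfD.
Proof. by move=> x; apply: linfP => j /=; rewrite add0r. Qed.
Let addN : left_inverse linf0 linfN linfD.
Proof. by move=> x; apply: linfP => j /=; rewrite addNr. Qed.
HB.instance Definition _ := GRing.isZmodule.Build E addA addC add0 addN.

Let scaleA a b x : linfZ a (linfZ b x) = linfZ (a * b) x.
Proof. by apply: linfP => j /=; rewrite scalerA. Qed.
Let scale1 : left_id 1 linfZ.
Proof. by move=> x; apply: linfP => j /=; rewrite scale1r. Qed.
Let scaleDr : right_distributive linfZ +%R.
Proof. by move=> a x y; apply: linfP => j /=; rewrite scalerDr. Qed.
Let scaleDl x : {morph linfZ^~ x : a b / a + b}.
Proof. by move=> a b; apply: linfP => j /=; rewrite scalerDl. Qed.
HB.instance Definition _ :=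
  GRing.Zmodule_isLmodule.Build R E scaleA scale1 scaleDr scaleDl.

(* [sup set0 = 0], so this is also the norm when J is empty. *)
Definition linf_norm x : R := sup (range (fun j => `|x j|)).

Lemma linf_norm_ub x j : `|x j| <= linf_norm x.
Proof.
apply: ub_le_sup; last by exists j.
by case: (linf_ex x) => M xM; exists M => _ [k _ <-].
Qed.

Lemma linf_norm_le x (M : R) :
  0 <= M -> (forall j, `|x j| <= M) -> linf_norm x <= M.
Proof.
move=> M0 xM; rewrite /linf_norm.
have [->|/set0P ne] := eqVneq (range (fun j => `|x j|)) set0.
  by rewrite sup0.
by apply: ge_sup => // _ [j _ <-].
Qed.

Lemma linf_norm_ge0 x : 0 <= linf_norm x.
Proof.
have [e|/set0P[_ [j _ _]]] := eqVneq (range (fun j => `|x j|)) set0.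
  by rewrite /linf_norm e sup0.
exact: le_trans (normr_ge0 (x j)) (linf_norm_ub x j).
Qed.

Let normD x y : linf_norm (x + y) <= linf_norm x + linf_norm y.
Proof.
apply: linf_norm_le; first by rewrite addr_ge0 ?linf_norm_ge0.
move=> j /=; apply: le_trans (ler_normD _ _) _.
by apply: lerD; exact: linf_norm_ub.
Qed.

Let normZ (a : R) x : linf_norm (a *: x) = `|a| * linf_norm x.
Proof.
have le b y : linf_norm (b *: y) <= `|b| * linf_norm y.
  apply: linf_norm_le; first by rewrite mulr_ge0 ?linf_norm_ge0.
  by move=> j /=; rewrite normrZ ler_wpM2l// linf_norm_ub.
apply/eqP; rewrite eq_le le/=; have [->|a0] := eqVneq a 0.
  by rewrite normr0 mul0r linf_norm_ge0.
have := le a^-1 (a *: x).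
by rewrite scalerA mulVf// scale1r normfV mulrC ler_pdivlMr ?normr_gt0// mulrC.
Qed.

Let norm0_eq0 x : linf_norm x = 0 -> x = 0.
Proof.
move=> x0; apply: linfP => j /=; apply/eqP; rewrite -normr_eq0 eq_le normr_ge0.
by rewrite andbT -x0 linf_norm_ub.
Qed.

HB.instance Definition _ := Lmodule_isNormed.Build R E normD normZ norm0_eq0.

Lemma linf_normE x : `|x| = sup (range (fun j => `|x j|)).
Proof. by []. Qed.

End linf_normed.

Section PC.
Variables (R : realType) (W : normedModType R).
Implicit Types f g : {nonneg R} -> W.

Definition right_of (t : {nonneg R}) : set_system {nonneg R} :=
  within [set s | t < s] (nbhs t).
Definition left_of (t : {nonneg R}) : set_system {nonneg R} :=
  within [set s | s < t] (nbhs t).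

Definition discontinuities f : set {nonneg R} :=
  [set t | ~ {for t, continuous f}].

(* No one-sided continuity is imposed at the jumps: the concatenation axiom
   below keeps the value of the first input at the switching time, so
   right-continuous functions would not form an input space. *)
Record piecewise_continuous f : Prop := PiecewiseContinuous {
  pc_finite : forall T : {nonneg R},
    finite_set (discontinuities f `&` [set t | t <= T]) ;
  pc_right : forall t : {nonneg R}, exists l : W, f @ right_of t --> l ;
  pc_left : forall t : {nonneg R}, 0 < t%:num -> exists l : W, f @ left_of t --> l }.

Lemma nonneg_ballE (t : {nonneg R}) e :
  ball t e = [set s | `|t%:num - s%:num| < e].
Proof. by []. Qed.

Lemma nonneg_nbhsP (t : {nonneg R}) (A : set {nonneg R}) :
  nbhs t A <-> exists2 e : R, 0 < e &
    forall s : {nonneg R}, `|t%:num - s%:num| < e -> A s.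
Proof.
split; first by move/nbhs_ballP => [e /= e0 sA]; exists e.
by move=> [e e0 sA]; apply/nbhs_ballP; exists e.
Qed.

#[local] Instance right_of_filter t : Filter (right_of t).
Proof. exact: within_filter. Qed.
#[local] Instance left_of_filter t : Filter (left_of t).
Proof. exact: within_filter. Qed.

Lemma pc_comb (a : R) f g : piecewise_continuous f -> piecewise_continuous g ->
  piecewise_continuous (a *: f + g).
Proof.
have comb (F : set_system {nonneg R}) (l m : W) : Filter F -> f @ F --> l ->
    g @ F --> m -> (a *: f + g) @ F --> a *: l + m.
  by move=> FF fl gm; apply: (cvgD (f := a *: f)) => //; exact: cvgZl_tmp.
move=> [f1 f2 f3] [g1 g2 g3]; split.
- move=> T; apply: (@sub_finite_set _ _
    ((discontinuities f `&` [set t | t <= T]) `|`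
     (discontinuities g `&` [set t | t <= T]))); last first.
    by rewrite finite_setU; split.
  move=> t [/= nc tT]; apply: contrapT => /not_orP[/not_andP nf /not_andP ng].
  apply: nc; apply: (comb (nbhs t)).
    by case: nf => //; exact: contrapT.
  by case: ng => //; exact: contrapT.
- move=> t; case: (f2 t) => l fl; case: (g2 t) => m gm; exists (a *: l + m).
  exact: comb.
- move=> t t0; case: (f3 t t0) => l fl; case: (g3 t t0) => m gm.
  by exists (a *: l + m); exact: comb.
Qed.

Lemma pc_cst (c : W) : piecewise_continuous (fun=> c).
Proof.
split=> [T|t|t _]; last 2 first.
- by exists c; exact: cvg_cst.
- by exists c; exact: cvg_cst.
rewrite (_ : _ `&` _ = set0)//; apply/seteqP; split => // t [/= + _].
by apply; apply: (@cvg_cst _ _ _ (nbhs t)).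
Qed.

Lemma pc_shift f (tau : {nonneg R}) : piecewise_continuous f ->
  piecewise_continuous (shift tau f).
Proof.
move=> [f1 f2 f3].
have inj : injective (fun t => add_time t tau).
  by move=> s t /(congr1 (fun t => t%:num)) /= /addIr /val_inj.
have nb (t : {nonneg R}) : (fun s => add_time s tau) @ t --> add_time t tau.
  move=> A /nonneg_nbhsP[e e0 eA]; apply/nonneg_nbhsP; exists e => // s st.
  by apply: eA; rewrite /= opprD addrACA subrr addr0.
split.
- move=> T; have := f1 (add_time T tau) => fin.
  have := finite_preimage (in2W inj) fin.
  apply: sub_finite_set => t [/= nc tT]; split => //=; last first.
    by rewrite -num_le/= lerD2r.
  by move=> cf; apply: nc; exact: (cvg_comp _ _ (nb t) cf).
- move=> t; have [l fl] := f2 (add_time t tau); exists l.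
  apply: cvg_comp fl => A; rewrite /right_of /= => nA.
  change (nbhs t [set s | t < s -> A (add_time s tau)]).
  have h := nb t _ nA; apply: (@filterS _ (nbhs t) _ _ _ _ h) => s /= + ts; apply.
  by rewrite -num_lt/= ltrD2r.
- move=> t t0; have [|l fl] := f3 (add_time t tau).
    by rewrite /= ltr_wpDr.
  exists l; apply: cvg_comp fl => A; rewrite /left_of /= => nA.
  change (nbhs t [set s | s < t -> A (add_time s tau)]).
  have h := nb t _ nA; apply: (@filterS _ (nbhs t) _ _ _ _ h) => s /= + ts; apply.
  by rewrite -num_lt/= ltrD2r.
Qed.

Lemma pc_concat f g (t : {nonneg R}) : piecewise_continuous f ->
  piecewise_continuous g -> piecewise_continuous (concat t f g).
Proof.
move=> [f1 f2 f3] [g1 g2 g3].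
pose m (s : {nonneg R}) := dist_time s t.
have mE (s : {nonneg R}) : t <= s -> (m s)%:num = s%:num - t%:num.
  by move=> ts /=; rewrite ger0_norm// subr_ge0.
have nb (s : {nonneg R}) : m @ s --> m s.
  move=> A /nonneg_nbhsP[e e0 eA]; apply/nonneg_nbhsP; exists e => // s' ss.
  apply: eA; rewrite /m/=; apply: le_lt_trans (ler_dist_dist _ _) _.
  by rewrite opprB addrA subrK.
have lo (s : {nonneg R}) : s < t -> \forall x \near s, f x = concat t f g x.
  move=> st; apply/nonneg_nbhsP; exists (t%:num - s%:num).
    by rewrite subr_gt0 num_lt.
  move=> x /ltr_distlCDr; rewrite /concat -num_le.
  by rewrite subrKC => /ltW ->.
have hi (s : {nonneg R}) : t < s -> \forall x \near s, t < x.
  move=> st; apply/nonneg_nbhsP; exists (s%:num - t%:num).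
    by rewrite subr_gt0 num_lt.
  move=> x /ltr_distlBl; rewrite -num_lt.
  by rewrite subKr.
have hiE (x : {nonneg R}) : t < x -> (g \o m) x = concat t f g x.
  by move=> tx; rewrite /concat leNgt tx.
have eqc (F : set_system {nonneg R}) (h k : {nonneg R} -> W) (l : W) : Filter F ->
    F [set x | h x = k x] -> h @ F --> l -> k @ F --> l.
  by move=> FF hk; apply: cvg_trans; exact: near_eq_cvg.
split.
- move=> T; apply: (@sub_finite_set _ _
    ((discontinuities f `&` [set s | s <= T]) `|` [set t] `|`
     [set add_time t r | r in (discontinuities g `&` [set s | s <= T])])).
    move=> s [/= nc sT]; have [st|ts|->] := ltgtP s t; last by left; right.
      left; left; split=> // cf; apply: nc.
      rewrite /prop_for/= /continuous_at -(nbhs_singleton (lo _ st)).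
      exact: (eqc (nbhs s) _ _ _ _ (lo _ st) cf).
    right; exists (m s); last first.
      by apply/val_inj => /=; rewrite (mE _ (ltW ts)) subrKC.
    split => /=; last first.
      by rewrite -num_le mE ?(ltW ts)// lerBlDr ler_wpDr.
    move=> cg; apply: nc; rewrite /prop_for/= /continuous_at -hiE//.
    apply: (eqc (nbhs s) (g \o m)); last exact: (cvg_comp _ _ (nb s) cg).
    by apply: (@filterS _ (nbhs s) _ _ _ _ (hi _ ts)) => x; exact: hiE.
  rewrite !finite_setU; split; first by split => //; exact: f1.
  exact: finite_image (g1 T).
- move=> s; have [st|ts] := ltP s t.
    have [l fl] := f2 s; exists l; apply: (eqc (right_of s) f) fl.
    change (nbhs s [set x | s < x -> f x = concat t f g x]).
    by apply: (@filterS _ (nbhs s) _ _ _ _ (lo _ st)) => x /= fx _.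
  have [l gl] := g2 (m s); exists l.
  apply: (eqc (right_of s) (g \o m)).
    change (nbhs s [set x | s < x -> (g \o m) x = concat t f g x]).
    apply: (@filterS _ (nbhs s) _ _ _ _ filterT) => x _ /= sx.
    by apply: hiE; exact: le_lt_trans sx.
  apply: cvg_comp gl => A; rewrite /right_of /= => nA.
  change (nbhs s [set x | s < x -> A (m x)]).
  have h := nb s _ nA; apply: (@filterS _ (nbhs s) _ _ _ _ h) => x /= + sx.
  apply; rewrite -num_lt (mE _ ts) mE ?ltrD2r//.
  exact: le_trans ts (ltW sx).
- move=> s s0; have [st|ts] := leP s t.
    have [l fl] := f3 s s0; exists l; apply: (eqc (left_of s) f) fl.
    change (nbhs s [set x | x < s -> f x = concat t f g x]).
    apply: (@filterS _ (nbhs s) _ _ _ _ filterT) => x _ /= xs.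
    by rewrite /concat (ltW (lt_le_trans xs st)).
  have [|l gl] := g3 (m s).
    by rewrite (mE _ (ltW ts)) subr_gt0 num_lt.
  exists l; apply: (eqc (left_of s) (g \o m)).
    change (nbhs s [set x | x < s -> (g \o m) x = concat t f g x]).
    apply: (@filterS _ (nbhs s) _ _ _ _ (hi _ ts)) => x tx /= xs.
    exact: hiE.
  apply: cvg_comp gl => A; rewrite /left_of /= => nA.
  change (nbhs s [set x | x < s -> A (m x)]).
  have h := nb s _ nA.
  apply: (@filterS2 _ (nbhs s) _ _ _ _ _ h (hi s ts)) => x /= + tx xs; apply.
  by rewrite -num_lt (mE _ (ltW ts)) mE ?(ltW tx)// ltrD2r.
Qed.

End PC.

Section PCb.
Variables (R : realType) (W : normedModType R).

Definition pc_pred : {pred linf (fun _ : {nonneg R} => W)} :=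
  fun w => `[< piecewise_continuous w >].

Lemma pc_pred_submod : submod_closed pc_pred.
Proof.
split; first exact/asboolP/pc_cst.
by move=> a f g /asboolP fpc /asboolP gpc; apply/asboolP; exact: pc_comb.
Qed.

HB.instance Definition _ := GRing.isSubmodClosed.Build R _ pc_pred
  (GRing.submod_closed_semi pc_pred_submod).

Record PCb := MkPCb {
  pcb_linf :> linf (fun _ : {nonneg R} => W) ;
  pcb_pc : pcb_linf \in pc_pred }.

HB.instance Definition _ := [isSub of PCb for pcb_linf].
HB.instance Definition _ := [Choice of PCb by <:].
HB.instance Definition _ := [SubChoice_isSubLmodule of PCb by <:].

Let norm (w : PCb) : R := `|pcb_linf w|.

Let normD (x y : PCb) : norm (x + y) <= norm x + norm y.
Proof. exact: ler_normD. Qed.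
Let normZ (a : R) (x : PCb) : norm (a *: x) = `|a| * norm x.
Proof. exact: normrZ. Qed.
Let norm0_eq0 (x : PCb) : norm x = 0 -> x = 0.
Proof. by move=> /normr0_eq0 x0; apply/val_inj. Qed.

HB.instance Definition _ := Lmodule_isNormed.Build R PCb normD normZ norm0_eq0.

Lemma pcb_normE (w : PCb) : `|w| = sup (range (fun t => `|w t|)).
Proof. by []. Qed.

End PCb.

(* The linear subspace is presented by an injective linear evaluation map. *)
Record input_space (R : realType) := InputSpace {
  input_value : lmodType R ;
  inputs :> normedModType R ;
  input_eval : {linear inputs -> ({nonneg R} -> input_value)} ;
  input_eval_inj : injective input_eval ;
  input_shift : forall (u : inputs) (tau : {nonneg R}),
    exists2 v : inputs, input_eval v = shift tau (input_eval u) & `|v| <= `|u| ;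
  input_concat : forall (u1 u2 : inputs) (t : {nonneg R}), 0 < t%:num ->
    exists v : inputs, input_eval v = concat t (input_eval u1) (input_eval u2) }.

Section product_input.
Variables (R : realType) (W : normedModType R) (U : input_space R).
Local Notation P := (PCb W * inputs U)%type.

Definition prod_eval (wu : P) : {nonneg R} -> (W * input_value U)%type :=
  fun t => (wu.1 t, input_eval U wu.2 t).

Lemma prod_eval_linear : linear prod_eval.
Proof.
move=> a [w u] [w' u']; apply/funext => t.
by rewrite /prod_eval/= linearP.
Qed.
HB.instance Definition _ :=
  GRing.isLinear.Build R P _ _ prod_eval prod_eval_linear.

Lemma prod_eval_inj : injective prod_eval.
Proof.
move=> [w u] [w' u'] /= e; congr pair.
  by apply/val_inj/linfP => t; have := congr1 (fun f => (f t).1) e.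
by apply: (@input_eval_inj _ U); apply/funext => t;
  have := congr1 (fun f => (f t).2) e.
Qed.

Lemma prod_shift (wu : P) (tau : {nonneg R}) :
  exists2 v : P, prod_eval v = shift tau (prod_eval wu) & `|v| <= `|wu|.
Proof.
case: wu => w u; have [v vE vu] := input_shift u tau.
have bnd : `[< exists M : R, forall t, `|shift tau w t| <= M >].
  by apply/asboolP; have [M wM] := linf_ex w; exists M => t; exact: wM.
have pc : @Linf R _ (fun=> W) _ bnd \in @pc_pred R W.
  by apply/asboolP/pc_shift; exact/asboolP/pcb_pc.
exists (MkPCb pc, v).
  by apply/funext => t; rewrite /prod_eval/= vE.
rewrite ge_max !le_max vu orbT andbT; apply/orP; left.
by apply: linf_norm_le => // t; exact: (linf_norm_ub (pcb_linf w) (add_time t tau)).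
Qed.

Lemma prod_concat (u1 u2 : P) (t : {nonneg R}) : 0 < t%:num ->
  exists v : P, prod_eval v = concat t (prod_eval u1) (prod_eval u2).
Proof.
move: u1 u2 => [w1 u1] [w2 u2] t0; have [v vE] := input_concat u1 u2 t0.
have bnd : `[< exists M : R, forall s, `|concat t w1 w2 s| <= M >].
  apply/asboolP; have [M wM] := linf_ex w1; have [N wN] := linf_ex w2.
  exists (Num.max M N) => s; rewrite /concat.
  by case: ifP => _; rewrite le_max ?wM ?wN ?orbT.
have pc : @Linf R _ (fun=> W) _ bnd \in @pc_pred R W.
  by apply/asboolP/pc_concat; exact/asboolP/pcb_pc.
exists (MkPCb pc, v); apply/funext => s.
by rewrite /prod_eval/= vE /concat; case: ifP.
Qed.

Definition product_input : input_space R :=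
  @InputSpace R _ P prod_eval prod_eval_inj prod_shift prod_concat.

End product_input.

Section comparison_functions.
Variable R : realType.
Implicit Type g : R -> R.

(* A function on the nonnegative reals is a function [R -> R] of which only
   the restriction to [0, +oo[ is used. *)
Definition classK g : Prop :=
  [/\ g 0 = 0,
      {within `[0, +oo[, continuous g} &
      {in `[0, +oo[ &, {homo g : r s / r < s}} ].

Definition classKinfty g : Prop :=
  classK g /\ forall M : R, exists2 r : R, 0 <= r & M < g r.

Definition classK0 g : Prop :=
  classK g \/ (forall r : R, 0 <= r -> g r = 0).

Lemma classK_ge0 g (r : R) : classK g -> 0 <= r -> 0 <= g r.
Proof.
move=> [g0 _ gmono]; rewrite le_eqVlt => /predU1P[<-|r0]; first by rewrite g0.
by rewrite -g0 ltW// gmono// in_itv/= andbT ?lexx// ltW.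
Qed.

Lemma classK0_ge0 g (r : R) : classK0 g -> 0 <= r -> 0 <= g r.
Proof. by move=> [/classK_ge0|g0 r0]; [exact|rewrite g0]. Qed.

Lemma classK0_le g (r s : R) : classK0 g -> 0 <= r -> r <= s -> g r <= g s.
Proof.
move=> [[_ _ gmono]|g0] r0 rs; last by rewrite !g0// (le_trans r0 rs).
move: rs; rewrite le_eqVlt => /predU1P[->//|rs].
by rewrite ltW// gmono// in_itv/= andbT// (le_trans r0 (ltW rs)).
Qed.

End comparison_functions.

Section control_systems.
Variables (R : realType) (X : normedModType R) (U : input_space R).

(* A partial map; the value of [pmap_val] outside [pmap_dom] is irrelevant. *)
Record pmap := PMap {
  pmap_dom : {nonneg R} -> X -> U -> Prop ;
  pmap_val :> {nonneg R} -> X -> U -> X }.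

Definition pmap_extends (phi psi : pmap) : Prop := forall t x u,
  pmap_dom phi t x u -> pmap_dom psi t x u /\ psi t x u = phi t x u.

Definition pmap_eq (phi psi : pmap) : Prop :=
  pmap_extends phi psi /\ pmap_extends psi phi.

Definition tmax (phi : pmap) (x : X) (u : U) : \bar R :=
  ereal_sup [set t%:num%:E | t in [set t | pmap_dom phi t x u]].

(* In [cs_cocycle] the equality asserts that its left-hand side is defined. *)
Record is_control_system (phi : pmap) : Prop := IsControlSystem {
  cs_tmax_gt0 : forall x u, (0 < tmax phi x u)%E ;
  cs_domE : forall t x u,
    pmap_dom phi t x u <-> (t%:num%:E < tmax phi x u)%E ;
  cs_id : forall x u, phi 0%:nng x u = x ;
  cs_causal : forall t x (u v : U), pmap_dom phi t x u ->
    (forall s : {nonneg R}, s <= t -> input_eval U u s = input_eval U v s) ->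
    (forall s : {nonneg R}, s <= t -> pmap_dom phi s x v) /\
    phi t x u = phi t x v ;
  cs_continuous : forall x u,
    {within [set t | pmap_dom phi t x u], continuous (fun t => phi t x u)} ;
  cs_cocycle : forall t h x (u v : U),
    (forall s : {nonneg R}, s <= add_time t h -> pmap_dom phi s x u) ->
    input_eval U v = shift t (input_eval U u) ->
    pmap_dom phi h (phi t x u) v /\
    phi h (phi t x u) v = phi (add_time t h) x u }.

Record control_system := ControlSystem {
  transition :> pmap ;
  control_systemP : is_control_system transition }.

Definition forward_complete (S : control_system) : Prop :=
  forall t x u, pmap_dom S t x u.

Definition BIC (S : control_system) : Prop :=
  forall x u, (tmax S x u < +oo)%E -> forall M : R, 0 < M ->
    exists2 t : {nonneg R}, (t%:num%:E < tmax S x u)%E & M < `|S t x u|.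

Definition UGS (S : control_system) : Prop :=
  exists sigma gamma : R -> R, [/\ classKinfty sigma, classK0 gamma &
    forall t x u, pmap_dom S t x u ->
      `|S t x u| <= sigma `|x| + gamma `|u| ].

End control_systems.

Section interconnection.
Variables (R : realType) (I : eqType) (X : I -> normedModType R).
Variable U : input_space R.

Definition linf_neq (i : I) : normedModType R :=
  linf (fun j : {j : I | j != i} => X (val j)).

Definition subsystem (i : I) : Type :=
  control_system (X i) (product_input (linf_neq i) U).

Variable Sigma : forall i : I, subsystem i.

(* The signal [w] stands for the trajectories of the other subsystems, of which
   only the restriction to [0, t] matters: by causality the value at time t
   does not depend on the choice of [w]. *)
Definition couples (phi : pmap (linf X) U) : Prop :=
  (forall x u, exists2 eps : {nonneg R}, 0 < eps%:num &
     forall t : {nonneg R}, t <= eps -> pmap_dom phi t x u) /\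
  (forall t x u, pmap_dom phi t x u ->
     (forall s : {nonneg R}, s <= t -> pmap_dom phi s x u) /\
     forall i : I, exists w : PCb (linf_neq i),
       [/\ forall (s : {nonneg R}) j, s <= t -> w s j = phi s x u (val j),
           pmap_dom (Sigma i) t (x i) (w, u) &
           phi t x u i = Sigma i t (x i) (w, u)]).

Definition maximal_coupling (phi : pmap (linf X) U) : Prop :=
  couples phi /\
  forall psi, couples psi -> pmap_extends phi psi -> pmap_eq phi psi.

Definition is_interconnection (S : control_system (linf X) U) : Prop :=
  [/\ maximal_coupling S,
      forall psi, maximal_coupling psi -> pmap_eq psi S &
      BIC S].

End interconnection.

Definition signal_norm (R : realType) (W : normedModType R)
    (t : {nonneg R}) (w : {nonneg R} -> W) : R :=
  sup [set `|w s| | s in [set s : {nonneg R} | s <= t]].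

(* The summand j = i of the estimate is 0 and [w] has no component i, so the
   sum ranges over the indices different from i. *)
Record UGS_summation (R : realType) (I : countType) (X : I -> normedModType R)
    (U : input_space R) (i : I) (S : subsystem X U i)
    (sigma : R -> R) (gamma : I -> R -> R) (gamma_u : R -> R) : Prop :=
  UGSSummation {
    ugs_forward_complete : forward_complete S ;
    ugs_sigma : classK sigma ;
    ugs_gamma : forall j, classK0 (gamma j) ;
    ugs_gamma_u : classK0 gamma_u ;
    ugs_gamma_diag : forall r : R, 0 <= r -> gamma i r = 0 ;
    ugs_summable : forall r : R, 0 <= r ->
      (\esum_(j in [set: I]) (gamma j r)%:E < +oo)%E ;
    ugs_estimate : forall (t : {nonneg R}) (x : X i)
        (w : PCb (linf_neq X i)) (u : U),
      (`|S t x (w, u)|%:E <=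
         (sigma `|x|)%:E +
         \esum_(j in [set: {j : I | j != i}])
           (gamma (val j) (signal_norm t (fun s => w s j)))%:E +
         (gamma_u `|u|)%:E)%E }.

Definition ell_infty (R : realType) (I : Type) : normedModType R :=
  linf (fun _ : I => R^o).

Definition nonneg_cone (R : realType) (I : Type) : set (ell_infty R I) :=
  [set s | forall i, 0 <= s i].

Definition MBI (R : realType) (E : normedModType R) (P : set E) (A : E -> E) :
    Prop :=
  exists2 xi : R -> R, classKinfty xi &
    forall v w : E, P v -> P w -> P (w - (v - A v)) -> `|v| <= xi `|w|.

(* [Gamma_boxplus] is only used on [nonneg_cone], under the hypotheses of
   [Gamma_boxplusE]; [insubd] supplies 0 where the sums are not bounded. *)
Definition Gamma_boxplus (R : realType) (I : countType)
    (gamma : I -> I -> R -> R) (s : ell_infty R I) : ell_infty R I :=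
  insubd (0 : ell_infty R I)
    (fun i => fine (\esum_(j in [set: I]) (gamma i j (s j))%:E)).

Lemma Gamma_boxplusE (R : realType) (I : countType)
    (gamma : I -> I -> R -> R) (s : ell_infty R I) :
  (forall i j, classK0 (gamma i j)) ->
  (forall r : R, 0 < r -> (ereal_sup (range (fun i =>
     \esum_(j in [set: I]) (gamma i j r)%:E)) < +oo)%E) ->
  nonneg_cone s ->
  forall i, (Gamma_boxplus gamma s i)%:E =
    \esum_(j in [set: I]) (gamma i j (s j))%:E.
Proof.
move=> gK gsup s0 i.
pose r := `|s| + 1.
have r0 : 0 < r by rewrite ltr_wpDl.
have sr j : s j <= r.
  apply: le_trans (ler_norm _) _.
  by apply: le_trans (linf_norm_ub s j) _; rewrite lerDl.
pose F k := \esum_(j in [set: I]) (gamma k j (s j))%:E.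
have F0 k : (0 <= F k)%E.
  by apply: esum_ge0 => j _; rewrite lee_fin classK0_ge0.
have [M FM] : exists M : R, forall k, (F k <= M%:E)%E.
  exists (fine (ereal_sup (range (fun k =>
    \esum_(j in [set: I]) (gamma k j r)%:E)))) => k.
  have ub : (\esum_(j in [set: I]) (gamma k j r)%:E <=
      ereal_sup (range (fun k => \esum_(j in [set: I]) (gamma k j r)%:E)))%E.
    by apply: ereal_sup_ubound; exists k.
  have le : (F k <= \esum_(j in [set: I]) (gamma k j r)%:E)%E.
    by apply: le_esum => j _; rewrite lee_fin classK0_le.
  rewrite fineK; first exact: le_trans le ub.
  rewrite ge0_fin_numE ?gsup//; exact: le_trans (F0 k) (le_trans le ub).
have Ffin k : F k \is a fin_num.
  by rewrite ge0_fin_numE// (le_lt_trans (FM k))// ltry.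
have bnd : `[< exists N : R, forall k, `|fine (F k) : R^o| <= N >].
  apply/asboolP; exists M => k; rewrite ger0_norm ?fine_ge0//.
  by rewrite -lee_fin fineK.
rewrite /Gamma_boxplus (_ : insubd _ _ = @Linf R I (fun=> R^o) _ bnd).
  by rewrite /= fineK.
by apply/val_inj; rewrite val_insubd bnd.
Qed.

(* Main.v *)
(** The running suprema [v i] of the components of a trajectory on [0, t]
satisfy [v - Gamma v <= sigma_max |x| + gamma_max |u|], so the MBI property
bounds them independently of t; this estimate is UGS, and together with BIC it
excludes finite escape times.  The one point that needs care is that [v] lies
in ell_infty: the coupling equation of a single subsystem i provides a bounded
signal that carries all components other than i, and the gain estimate then
bounds component i itself. *)
Require Import Defs.
From mathcomp Require Import all_boot all_order all_algebra.
From mathcomp Require Import all_classical all_reals all_analysis.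

Import Order.TTheory GRing.Theory Num.Theory numFieldNormedType.Exports.

Local Open Scope classical_set_scope.
Local Open Scope ring_scope.

Lemma classK_le (R : realType) (f : R -> R) (r s : R) :
  classK f -> 0 <= r -> r <= s -> f r <= f s.
Proof. by move=> fK; apply: classK0_le; left. Qed.

(** The continuity of [f] is relative to the half-line, so the composition is controlled only
    because [g] maps the half-line into itself. *)
Lemma within_nonneg_continuous_comp (R : realType) (f g : R -> R) :
  {within `[0, +oo[, continuous f} -> {within `[0, +oo[, continuous g} ->
  {homo g : r / 0 <= r} -> {within `[0, +oo[, continuous (f \o g)}.
Proof.
move=> /subspace_continuousP fc /subspace_continuousP gc g0.
apply/subspace_continuousP => r r0.
have gr0 : `[0, +oo[%classic (g r).
  by move: r0; rewrite /= !in_itv/= !andbT; exact: g0.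
apply: cvg_comp (fc _ gr0) => A nA.
change (nbhs r [set s | `[0, +oo[%classic s -> A (g s)]).
have := gc _ r0 _ nA.
apply: (@filterS _ (nbhs r)) => s + s0; move=> /(_ s0); apply.
by move: s0; rewrite /= !in_itv/= !andbT; exact: g0.
Qed.

Lemma classK_comp (R : realType) (f g : R -> R) :
  classK f -> classK g -> classK (f \o g).
Proof.
move=> [f0 fc fm] gK; have [g0 gc gm] := gK.
have gge r : 0 <= r -> 0 <= g r by exact: classK_ge0.
split; first by rewrite /= g0.
  exact: within_nonneg_continuous_comp.
move=> r s r0 s0 rs /=.
by apply: fm; [| |exact: gm]; rewrite in_itv/= andbT;
  apply: gge; move: r0 s0; rewrite !in_itv/= !andbT.
Qed.

Lemma classKinfty_comp (R : realType) (f g : R -> R) :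
  classKinfty f -> classKinfty g -> classKinfty (f \o g).
Proof.
move=> [fK fu] [gK gu]; split; first exact: classK_comp.
move=> M; have [r r0 Mr] := fu M; have [s s0 rs] := gu r.
by exists s => //=; apply: (lt_le_trans Mr); apply: classK_le => //; exact: ltW.
Qed.

Lemma classKinfty_scale (R : realType) (a : R) :
  0 < a -> classKinfty ( *%R a).
Proof.
move=> a0; split; last first.
  move=> M; exists ((`|M| + 1) / a).
    by rewrite divr_ge0 ?addr_ge0 ?(ltW a0).
  by rewrite mulrC divfK ?gt_eqF// (le_lt_trans (ler_norm M))// ltrDl.
split; first exact: mulr0.
  by apply: continuous_subspaceT => r; exact: mulrl_continuous.
by move=> r s _ _ rs; rewrite ltr_pM2l.
Qed.

(** A sum is at most twice its larger term. This weak triangle inequality splits [xi] of a sum into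
    a state term and an input term, as UGS requires. *)
Lemma classK_leD (R : realType) (f : R -> R) (a b : R) :
  classK f -> 0 <= a -> 0 <= b -> f (a + b) <= f (2 * a) + f (2 * b).
Proof.
move=> fK; wlog ab : a b / a <= b => [hw a0 b0|a0 b0].
  have [/hw|/ltW ba] := leP a b; first exact.
  by rewrite addrC [leRHS]addrC hw.
rewrite (@le_trans _ _ (f (2 * b)))//.
  by apply: classK_le; rewrite ?addr_ge0// mulr_natl mulr2n lerD2r.
by rewrite lerDr classK_ge0// mulr_ge0.
Qed.

(** Bridges the subsystem estimate, summed over the indices other than i, and [Gamma_boxplus],
    summed over all of I. *)
Lemma esum_sig_le (R : realType) (T : choiceType) (P : pred T)
    (a : T -> \bar R) : (forall j, 0 <= a j)%E ->
  (\esum_(j in [set: {j : T | P j}]) a (val j) <=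
   \esum_(j in [set: T]) a j)%E.
Proof.
move=> a0; rewrite -(@reindex_esum R _ _ setT [set j | P j] val a).
  rewrite esum_mkcond; apply: le_esum => j _.
  by case: ifP => // _; exact: a0.
split; first by move=> j _ /=; exact: valP.
  by move=> j k _ _; exact: val_inj.
by move=> j Pj; exists (exist _ j Pj).
Qed.

Section coupling.
Context {R : realType} {I : countType} {X : I -> normedModType R}.
Context {U : input_space R} {Sigma : forall i : I, subsystem X U i}.
Context {phi : Defs.pmap (linf X) U} (phi_couples : couples Sigma phi).

(** Up to time t the signal [w] carries the other components, so each [signal_norm] is at most
    [v j], and the gains are monotone. Bounds are asked only for [j != i], so that the estimate
    applies before component i is known to be bounded. *)
Lemma coupling_estimate (i : I) (sigma : R -> R) (gamma : I -> R -> R)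
    (gamma_u : R -> R) (t : {nonneg R}) (x : linf X) (u : U) (v : I -> R) :
  UGS_summation (Sigma i) sigma gamma gamma_u ->
  pmap_dom phi t x u -> (forall j, 0 <= v j) ->
  (forall (s : {nonneg R}) j, s <= t -> j != i -> `|phi s x u j| <= v j) ->
  (`|phi t x u i|%:E <= (sigma `|x i|)%:E +
     \esum_(j in [set: I]) (gamma j (v j))%:E + (gamma_u `|u|)%:E)%E.
Proof.
move=> ugs dom v0 phiv.
have [_ /(_ i)[w [wE _ ->]]] := phi_couples.2 _ _ _ dom.
apply: le_trans (ugs_estimate ugs t (x i) w u) _.
rewrite leeD2r// leeD2l//.
have gK := ugs_gamma ugs.
pose a j : \bar R := (gamma j (v j))%:E.
have a0 j : (0 <= a j)%E by rewrite lee_fin classK0_ge0.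
apply: le_trans (esum_sig_le _ _ (fun j => j != i) a a0).
apply: le_esum => j _; rewrite lee_fin.
have wv (s : {nonneg R}) : s <= t -> `|w s j| <= v (val j).
  by move=> st; rewrite wE//; apply: phiv => //; exact: (valP j).
apply: classK0_le => //.
  (* Monotonicity of a gain holds on the nonnegative reals only, so the sign of the signal norm is
     checked first. *)
  apply: le_trans (normr_ge0 (w t j)) _; apply: ub_le_sup.
    by exists (v (val j)) => _ [s /= st <-]; exact: wv.
  by exists t => /=.
apply: ge_sup; first by exists `|w t j|; exists t => /=.
by move=> _ [s /= st <-]; exact: wv.
Qed.

Lemma coupling_bounded (i : I) (sigma : R -> R) (gamma : I -> R -> R)
    (gamma_u : R -> R) (t : {nonneg R}) (x : linf X) (u : U) :
  UGS_summation (Sigma i) sigma gamma gamma_u -> pmap_dom phi t x u ->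
  exists M : R, forall (s : {nonneg R}) j, s <= t -> `|phi s x u j| <= M.
Proof.
move=> ugs dom; have [sub /(_ i)[w [wE _ _]]] := phi_couples.2 _ _ _ dom.
have wN (s : {nonneg R}) (j : I) : s <= t -> j != i -> `|phi s x u j| <= `|w|.
  move=> st ji; rewrite -(wE s (exist _ j ji))//.
  apply: le_trans (linf_norm_ub (w s) _) _.
  exact: (linf_norm_ub (pcb_linf w) s).
have fin : \esum_(j in [set: I]) (gamma j `|w|)%:E \is a fin_num.
  rewrite ge0_fin_numE ?(ugs_summable ugs)//.
  by apply: esum_ge0 => j _; rewrite lee_fin classK0_ge0//;
    exact: (ugs_gamma ugs).
(* [|w|] bounds every component except i; the second entry is the estimate of component i with all
   gains evaluated at [|w|]. *)
exists (Num.max `|w| (sigma `|x i| +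
  fine (\esum_(j in [set: I]) (gamma j `|w|)%:E) + gamma_u `|u|)) => s j st.
rewrite le_max; have [->|ji] := eqVneq j i; last by rewrite wN.
apply/orP; right; rewrite -lee_fin !EFinD fineK//.
apply: (coupling_estimate i sigma gamma) => //; first exact: sub.
by move=> r k rs; apply: wN; exact: le_trans st.
Qed.

End coupling.

Theorem theorem6p4 (R : realType) (I : countType)
    (I_nonempty : [set: I] !=set0)
    (X : I -> normedModType R) (U : input_space R)
    (Sigma : forall i : I, control_system (X i) (product_input (linf_neq X i) U))
    (Sigma_fc : forall i : I, forward_complete (Sigma i))
    (S : control_system (linf X) U)
    (S_interconnection : is_interconnection Sigma S)
    (sigma : I -> R -> R) (gamma : I -> I -> R -> R) (gamma_u : I -> R -> R)
    (Sigma_UGS : forall i : I,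
       UGS_summation (Sigma i) (sigma i) (gamma i) (gamma_u i))
    (sigma_max gamma_max : R -> R)
    (sigma_maxK : classKinfty sigma_max) (gamma_maxK : classKinfty gamma_max)
    (sigma_le : forall (i : I) (r : R), 0 <= r -> sigma i r <= sigma_max r)
    (gamma_u_le : forall (i : I) (r : R), 0 <= r -> gamma_u i r <= gamma_max r)
    (gamma_bounded : forall r : R, 0 < r ->
       (ereal_sup (range (fun i : I =>
          \esum_(j in [set: I]) (gamma i j r)%:E)) < +oo)%E)
    (gamma_MBI : MBI (nonneg_cone (R := R) (I := I)) (Gamma_boxplus gamma)) :
  forward_complete S /\ UGS S.
Proof.
have SC : couples Sigma S by case: S_interconnection => -[].
have [xi xiKinf mbi] := gamma_MBI.
have [[xiK _] [smK _] [gmK _]] := And3 xiKinf sigma_maxK gamma_maxK.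
have gK i j : classK0 (gamma i j) by exact: ugs_gamma (Sigma_UGS i) j.
have bound t x u : pmap_dom S t x u ->
    `|S t x u| <= xi (2 * sigma_max `|x|) + xi (2 * gamma_max `|u|).
  move=> dom; have [sub _] := SC.2 _ _ _ dom.
  have [i0 _] := I_nonempty.
  have [M SM] := coupling_bounded SC _ _ _ _ _ _ _ (Sigma_UGS i0) dom.
  pose V i : set R := [set `|S s x u i| | s in [set s : {nonneg R} | s <= t]].
  have V_ub i : has_ubound (V i) by exists M => _ [s /= st <-]; exact: SM.
  have V_ne i : V i !=set0 by exists `|S t x u i|; exists t => /=.
  have Vle i (s : {nonneg R}) : s <= t -> `|S s x u i| <= sup (V i).
    by move=> st; apply: ub_le_sup => //; exists s.
  have V0 i : 0 <= sup (V i).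
    exact: le_trans (normr_ge0 (S t x u i)) (Vle i t (lexx t)).
  (* [M] depends neither on the time nor on the index, hence it bounds all the suprema at once. *)
  have v_bnd : `[< exists N : R, forall i, `|sup (V i) : R^o| <= N >].
    apply/asboolP; exists M => i; rewrite ger0_norm//.
    by apply: ge_sup => // _ [s /= st <-]; exact: SM.
  pose v : ell_infty R I := @Linf R I (fun=> R^o) _ v_bnd.
  pose c := sigma_max `|x| + gamma_max `|u|.
  have c0 : 0 <= c by rewrite addr_ge0// classK_ge0.
  have w_bnd : `[< exists N : R, forall i : I, `|c : R^o| <= N >].
    by apply/asboolP; exists `|c|.
  pose w : ell_infty R I := @Linf R I (fun=> R^o) _ w_bnd.
  (* Componentwise this says [sup (V i) <= c + Gamma_boxplus gamma v i]. The coupling estimate gives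
     it for each value at a time [s <= t], with a right-hand side free of s, so it passes to the
     supremum. *)
  have vw : nonneg_cone (w - (v - Gamma_boxplus gamma v)).
    move=> i; rewrite /= opprB addrA subr_ge0.
    apply: ge_sup => // _ [s /= st <-].
    rewrite -lee_fin EFinD (Gamma_boxplusE (s := v) gK gamma_bounded V0).
    apply: le_trans (coupling_estimate SC i _ _ _ s x u (fun j => sup (V j))
      (Sigma_UGS i) (sub _ st) V0 _) _.
      by move=> r j rs _; apply: Vle; exact: le_trans st.
    rewrite addeAC leeD2r// -EFinD lee_fin lerD ?gamma_u_le//.
    apply: le_trans (sigma_le _ _ (normr_ge0 _)) _.
    by apply: classK_le => //; exact: linf_norm_ub.
  have Sv : `|S t x u| <= `|v|.
    apply: linf_norm_le => // i; apply: le_trans (linf_norm_ub v i).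
    by rewrite /= ger0_norm//; exact: Vle.
  have wc : `|w| <= c by apply: linf_norm_le => // i /=; rewrite ger0_norm.
  apply: le_trans Sv _; apply: le_trans (mbi v w V0 (fun=> c0) vw) _.
  apply: (@le_trans _ _ (xi c)); first exact: classK_le.
  by apply: classK_leD => //; exact: classK_ge0.
split.
  move=> t x u; apply/(cs_domE (control_systemP S)).
  suff -> : tmax S x u = +oo%E by exact: ltry.
  apply/eqP; rewrite -leye_eq leNgt; apply/negP => fin.
  have [_ _ bic] := S_interconnection.
  pose B := xi (2 * sigma_max `|x|) + xi (2 * gamma_max `|u|).
  have B0 : 0 <= B by rewrite addr_ge0// classK_ge0// mulr_ge0// classK_ge0.
  (* BIC asks for a positive threshold, and [B] may be 0; exceeding [B + 1] contradicts [bound]. *)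
  have [|s /(cs_domE (control_systemP S)) dom] := bic x u fin (B + 1).
    by rewrite ltr_wpDl.
  by apply/negP; rewrite -leNgt (le_trans (bound _ _ _ dom))// lerDl.
have two f : classKinfty f -> classKinfty (xi \o ( *%R 2 \o f)).
  move=> fK; apply: classKinfty_comp => //.
  by apply: classKinfty_comp => //; exact: classKinfty_scale.
exists (xi \o ( *%R 2 \o sigma_max)), (xi \o ( *%R 2 \o gamma_max)).
by split; [exact: two|left; exact: (two _ gamma_maxK).1|exact: bound].
Qed.
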